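(* Let $G$ be a finite group, let $*$ be a nonidentical involutory antiautomorphism of $G$ with $gg^*\in Z(G)$ for every $g\in G$, and let $g_0\in Z(G)$ with $g_0^*=g_0$. Let $\beta\in\{xy,\,x^*y,\,yx,\,yx^*\}$, $\gamma\in\{xy,\,yx\}$ and $\delta\in\{g_0xy,\,g_0xy^*,\,g_0x^*y,\,g_0x^*y^*,\,g_0yx,\,g_0yx^*,\,g_0y^*x,\,g_0y^*x^*\}$. Then the loop $L=Q(G,*,g_0,\beta,\gamma,\delta)$ is Moufang if and only if at least one of the following holds: (a) $L$ is extra; (b) $(\beta,\gamma,\delta)=(x^*y,yx,g_0yx^* )$.
   Context: $Z(G)$ is the center of $G$. An involutory antiautomorphism $*$ of $G$ satisfies $(g^* )^*=g$ and $(gh)^*=h^*g^*$; nonidentical means $g^*\neq g$ for some $g\in G$. A word such as $yx^*$ or $g_0y^*x$ denotes the function $G\times G\to G$ sending $(x,y)$ to the value of the word. Words are regarded as functions: two words are identified when they define the same function on $G\times G$ (for instance $xy$ and $yx$ when $G$ is commutative), and equality of triples $(\beta,\gamma,\delta)$ means equality of the three functions. Let $Gu=\{gu : g\in G\}$ be a disjoint copy of $G$. The loop $Q(G,*,g_0,\beta,\gamma,\delta)$ is the set $G\cup Gu$ with the multiplication, for $x,y\in G$, $$x\circ y=xy,\quad x\circ yu=\beta(x,y)u,\quad xu\circ y=\gamma(x,y)u,\quad xu\circ yu=\delta(x,y).$$ It is a loop with neutral element $1\in G$. A loop is Moufang if it satisfies $x(y(xz))=((xy)x)z$, and extra if it satisfies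 $x(y(zx))=((xy)z)x$. *)

(* Defs.v *)
From HB Require Import structures.
From mathcomp Require Import all_boot all_fingroup all_solvable.

Set Implicit Arguments.
Unset Strict Implicit.
Unset Printing Implicit Defensive.

Local Open Scope group_scope.

Definition is_loop (T : Type) (op : T -> T -> T) (e : T) : Prop :=
  [/\ left_id e op, right_id e op,
      forall a, bijective (fun x => op a x) &
      forall a, bijective (fun x => op x a)].

Definition is_moufang_loop (T : Type) (op : T -> T -> T) (e : T) : Prop :=
  is_loop op e /\
  forall x y z, op x (op y (op x z)) = op (op (op x y) x) z.

Definition is_extra_loop (T : Type) (op : T -> T -> T) (e : T) : Prop :=
  is_loop op e /\
  forall x y z, op x (op y (op z x)) = op (op (op x y) z) x.

Definition involutory_antiaut (gT : finGroupType) (star : gT -> gT) : Prop :=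
  involutive star /\ forall g h, star (g * h) = star h * star g.

(* A word is identified with the finite function G x G -> G that it defines,
   so that Leibniz equality of words is equality of functions. *)
Notation wordfun gT := {ffun gT * gT -> gT}.

Definition word (gT : finGroupType) (w : gT -> gT -> gT) : wordfun gT :=
  [ffun p => w p.1 p.2].

Definition beta_words (gT : finGroupType) (star : gT -> gT) :
    {set wordfun gT} :=
  [set:: [:: word (fun x y => x * y);
             word (fun x y => star x * y);
             word (fun x y => y * x);
             word (fun x y => y * star x)]].

Definition gamma_words (gT : finGroupType) : {set wordfun gT} :=
  [set:: [:: word (fun x y => x * y);
             word (fun x y => y * x)]].

Definition delta_words (gT : finGroupType) (star : gT -> gT) (g0 : gT) :
    {set wordfun gT} :=
  [set:: [:: word (fun x y => g0 * x * y);
             word (fun x y => g0 * x * star y);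
             word (fun x y => g0 * star x * y);
             word (fun x y => g0 * star x * star y);
             word (fun x y => g0 * y * x);
             word (fun x y => g0 * y * star x);
             word (fun x y => g0 * star y * x);
             word (fun x y => g0 * star y * star x)]].

(* The carrier G \cup Gu is the disjoint sum gT + gT: [inl x] is the element x
   and [inr x] is xu.  The parameters star and g0 of Q(G,*,g0,beta,gamma,delta)
   enter the multiplication only through beta, gamma and delta. *)
Definition Qmul (gT : finGroupType) (beta gamma delta : wordfun gT)
    (a b : gT + gT) : gT + gT :=
  match a, b with
  | inl x, inl y => inl (x * y)
  | inl x, inr y => inr (beta (x, y))
  | inr x, inl y => inr (gamma (x, y))
  | inr x, inr y => inl (delta (x, y))
  end.

Definition Qone (gT : finGroupType) : gT + gT := inl 1.

Lemma Qmul_is_loop (gT : finGroupType) (star : gT -> gT) (g0 : gT)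
    (beta gamma delta : wordfun gT) :
  involutory_antiaut star ->
  beta \in beta_words star -> gamma \in gamma_words gT ->
  delta \in delta_words star g0 ->
  is_loop (Qmul beta gamma delta) (Qone gT).
Proof.
move=> [starK starM] hb hc hd.
have star_inj : injective star := can_inj starK.
have star1 : star 1 = 1.
  by apply: (mulgI (star 1)); rewrite -starM !mulg1.
have word_inj (S : {set wordfun gT}) :
    S \in [:: beta_words star; gamma_words gT; delta_words star g0] ->
    forall f, f \in S -> (forall x, injective (fun y => f (x, y))) /\
                        (forall y, injective (fun x => f (x, y))).
  move=> hS f; move: hS; rewrite !inE => /or3P[]/eqP->; rewrite !inE => hf;
  split=> z x y; repeat (case/orP: hf => hf); rewrite (eqP hf) !ffunE /=;
  do ?[by [] | move/mulgI | move/mulIg | move/star_inj].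
have [bl br] := word_inj _ (mem_head _ _) _ hb.
have [cl cr] : (forall x, injective (fun y => gamma (x, y))) /\
               (forall y, injective (fun x => gamma (x, y))).
  by apply: (word_inj (gamma_words gT)) => //; rewrite !inE eqxx orbT.
have [dl dr] : (forall x, injective (fun y => delta (x, y))) /\
               (forall y, injective (fun x => delta (x, y))).
  by apply: (word_inj (delta_words star g0)) => //; rewrite !inE eqxx !orbT.
split.
- case=> x /=; first by rewrite mul1g.
  by move: hb; rewrite !inE => /or4P[]/eqP->; rewrite ffunE /= ?star1 ?mulg1 ?mul1g.
- case=> x /=; first by rewrite mulg1.
  by move: hc; rewrite !inE => /orP[]/eqP->; rewrite ffunE /= ?mulg1 ?mul1g.
- move=> a; apply: injF_bij; case: a => a [x|x] [y|y] //= [] //.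
  + by move/mulgI->.
  + by move/bl->.
  + by move/cl->.
  + by move/dl->.
- move=> a; apply: injF_bij; case: a => a [x|x] [y|y] //= [] //.
  + by move/mulIg->.
  + by move/cr->.
  + by move/br->.
  + by move/dr->.
Qed.

(* Main.v *)
Require Import Defs.
From HB Require Import structures.
From mathcomp Require Import all_boot all_fingroup all_solvable.

(** Evaluating the Moufang law at a triple (xu, y, z) and then at x = 1 shows
    that delta(1,z) = g0 z, and hence that g0 beta(y,z) = delta(y,1) z: so beta
    is xy or x^*y according to whether delta involves x or x^*.  Of the eight
    triples that are left, one makes L a group, one is (b), and for the six
    others the same identity forces G to be commutative, so that they coincide
    as functions with one of the first two.  The converse uses that extra loops
    are Moufang. *)

Local Open Scope group_scope.

Lemma loop_mulI (T : Type) (op : T -> T -> T) (e : T) :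
  is_loop op e -> forall a, injective (op a).
Proof. by case=> _ _ opl _ a; apply: bij_inj (opl a). Qed.

Lemma loop_Imul (T : Type) (op : T -> T -> T) (e : T) :
  is_loop op e -> forall a, injective (op^~ a).
Proof. by case=> _ _ _ opr a; apply: bij_inj (opr a). Qed.

(** Choose x' with x' x = e. The extra law with z = x' collapses to (y x') x = y, and with y = x' to
    x (x' y) = y; cancelling x gives the other two identities. *)
Lemma extra_inverse_property (T : Type) (op : T -> T -> T) (e : T) :
  is_extra_loop op e ->
  forall x, exists x', (forall y, op x' (op x y) = y) /\
                       (forall y, op (op y x) x' = y) /\
                       (forall y, op x (op x' y) = y) /\
                       (forall y, op (op y x') x = y).
Proof.
move=> [L E] x; have mulI := loop_mulI _ _ _ L; have Imul := loop_Imul _ _ _ L.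
have [op1l op1r _ opr] := L.
have [g _ gK] := opr x; pose x' := g e; have x'x : op x' x = e by apply: gK.
have rK y : op (op y x') x = y.
  have [h _ hK] : bijective (op x) by case: L.
  by have := E x (h y) x'; rewrite x'x op1r hK => <-.
have xx' : op x x' = e by apply: (Imul x); rewrite /= rK op1l.
have lK y : op x (op x' y) = y.
  by have := E x x' (g y); rewrite gK xx' op1l gK.
exists x'; split=> [y|]; first by apply: (mulI x); rewrite lK.
by split=> // y; apply: (Imul x); rewrite /= rK.
Qed.

Lemma extra_right_moufang (T : Type) (op : T -> T -> T) (e : T) :
  is_extra_loop op e ->
  forall s x w, op (op (op s x) w) x = op s (op x (op w x)).
Proof.
move=> EL s x w; have [_ E] := EL; have IP := extra_inverse_property _ _ _ EL.
have [x' [x'K [Kx' [xK Kx]]]] := IP x.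
have conj p q : op (op x p) (op q x') = op (op x (op p q)) x'.
  by rewrite -{2}(Kx q) E Kx'.
(* The law [conj] at the pair (pq, q^-1), rearranged by taking inverses. *)
have conj2 p q : op (op (op x p) x') (op x q) = op x (op p q).
  have [q' [q'K [Kq' [qK Kq]]]] := IP q.
  have [m' [m'K [Km' [mK Km]]]] := IP (op x q).
  (* Inverses reverse products, by the inverse property alone. *)
  have m'E : m' = op q' x'.
    rewrite -[m' in LHS]q'K; congr (op q' _).
    by rewrite -{1}[q]x'K Km'.
  by rewrite -{1}(Kq' p) -conj -m'E Km.
(* For p = x' (s x) and q = w x, [conj] identifies x (p q) with ((s x) w) x, while [conj2]
   identifies it with s (x (w x)). *)
have := conj (op x' (op s x)) (op w x).
rewrite xK Kx' => ->.
by rewrite Kx -conj2 xK Kx'.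
Qed.

(* The extra law is self-dual, so the left Moufang law is the right one for the
   opposite loop. *)
Lemma extra_moufang (T : Type) (op : T -> T -> T) (e : T) :
  is_extra_loop op e -> is_moufang_loop op e.
Proof.
move=> [L E]; split=> // x y z.
suff EL : is_extra_loop (fun a b => op b a) e.
  by have := extra_right_moufang _ _ _ EL z x y.
by case: L => ? ? ? ?; split=> // a b c; rewrite E.
Qed.

Lemma eq_word (gT : finGroupType) (v w : gT -> gT -> gT) :
  (forall x y, v x y = w x y) -> word v = word w.
Proof. by move=> vw; apply/ffunP=> -[x y]; rewrite !ffunE. Qed.

Lemma centralT (gT : finGroupType) (c : gT) :
  c \in 'Z([set: gT]) -> forall h, c * h = h * c.
Proof. by case/centerP=> _ cC h; apply: cC. Qed.

Lemma star1 (gT : finGroupType) (star : gT -> gT) :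
  involutory_antiaut star -> star 1 = 1.
Proof. by case=> _ sM; apply: (mulgI (star 1)); rewrite -sM !mulg1. Qed.

Lemma star_comm (gT : finGroupType) (star : gT -> gT) (x : gT) :
  x * star x \in 'Z([set: gT]) -> star x * x = x * star x.
Proof. by move=> xZ; apply: (mulgI x); rewrite mulgA (centralT _ _ xZ). Qed.

(** With these words L is a group: G with a central element u adjoined such that u u = g0. *)
Lemma group_words_extra (gT : finGroupType) (star : gT -> gT) (g0 : gT) :
  involutory_antiaut star -> g0 \in 'Z([set: gT]) ->
  is_extra_loop (Qmul (word (fun x y => x * y)) (word (fun x y => x * y))
                      (word (fun x y => g0 * x * y))) (Qone gT).
Proof.
move=> star_antiaut /centralT g0C; split.
  by apply: (@Qmul_is_loop _ star g0) => //; rewrite !inE eqxx.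
have g0r x y : x * (g0 * y) = g0 * (x * y) by rewrite !mulgA g0C.
case=> x [y|y] [z|z]; rewrite /= ?ffunE /=; congr (_ _);
  by rewrite -?mulgA ?g0r.
Qed.

(** In each of the eight cases the two sides can differ only in where the central factors g0 and
    [x * star x] stand. So g0 is pulled to the front, and x and [star x] are brought together and
    moved as one. *)
Lemma star_words_moufang (gT : finGroupType) (star : gT -> gT) (g0 : gT) :
  involutory_antiaut star -> (forall g : gT, g * star g \in 'Z([set: gT])) ->
  g0 \in 'Z([set: gT]) -> star g0 = g0 ->
  is_moufang_loop (Qmul (word (fun x y => star x * y)) (word (fun x y => y * x))
                        (word (fun x y => g0 * y * star x))) (Qone gT).
Proof.
move=> star_antiaut star_central /centralT g0C g0_star; split.
  by apply: (@Qmul_is_loop _ star g0) => //; rewrite !inE eqxx ?orbT.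
have [starK starM] := star_antiaut.
have g0r x y : x * (g0 * y) = g0 * (x * y) by rewrite !mulgA g0C.
have sC x : star x * x = x * star x by apply: star_comm.
have nC x y : x * star x * y = y * (x * star x) by apply: centralT.
have nr x y z : x * (star x * (y * z)) = y * (x * (star x * z)).
  by rewrite (mulgA x) mulgA nC -!mulgA.
have sr x y : star x * (x * y) = x * (star x * y) by rewrite !mulgA sC.
case=> x [y|y] [z|z]; rewrite /= ?ffunE /=; congr (_ _);
  rewrite ?starM ?starK ?g0_star -?mulgA ?g0r ?sr -?mulgA //;
  by rewrite ?sC -?nC -?mulgA ?nr.
Qed.

Theorem theorem8p3 (gT : finGroupType) (star : gT -> gT) (g0 : gT)
    (beta gamma delta : {ffun gT * gT -> gT})
    (star_antiaut : involutory_antiaut star)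
    (star_nonid : exists g : gT, star g <> g)
    (star_central : forall g : gT, g * star g \in 'Z([set: gT]))
    (g0_central : g0 \in 'Z([set: gT]))
    (g0_star : star g0 = g0)
    (beta_in : beta \in beta_words star)
    (gamma_in : gamma \in gamma_words gT)
    (delta_in : delta \in delta_words star g0) :
  is_moufang_loop (Qmul beta gamma delta) (Qone gT) <->
  is_extra_loop (Qmul beta gamma delta) (Qone gT) \/
  (beta, gamma, delta) =
    (word (fun x y => star x * y), word (fun x y => y * x),
     word (fun x y => g0 * y * star x)).
Proof.
split; last first.
  by case=> [/(@extra_moufang _ _ _) // | [-> -> ->]]; apply: star_words_moufang.
case=> _ M; have [starK starM] := star_antiaut.
have s1 := star1 _ _ star_antiaut.
have D x y z : delta (x, beta (y, gamma (x, z))) =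
               delta (gamma (x, y), x) * z.
  by have [] := M (inr x) (inl y) (inl z).
have not_star : ~ (forall z, g0 * star z = g0 * z).
  by case: star_nonid => g ng g0g; apply: ng; apply: mulgI (g0g g).
have gamma1 : forall z, (gamma (1, z) = z) * (gamma (z, 1) = z).
  move: gamma_in; rewrite !inE => /orP[]/eqP-> z; rewrite !ffunE /=;
  by rewrite mulg1 mul1g.
have beta1 z : beta (1, z) = z.
  move: beta_in; rewrite !inE => /or4P[]/eqP->;
  by rewrite !ffunE /= ?s1 ?mulg1 ?mul1g.
have delta11 : delta (1, 1) = g0.
  by move: delta_in; rewrite !inE;
    do ?[case/orP]; move/eqP->; rewrite !ffunE /= ?s1 ?mulg1.
have delta1 z : delta (1, z) = g0 * z.
  by have := D 1 1 z; rewrite !gamma1 beta1 delta11.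
have betaE y z : g0 * beta (y, z) = delta (y, 1) * z.
  by have := D 1 y z; rewrite !gamma1 delta1.
have betaw w : (forall y, delta (y, 1) = g0 * w y) ->
    beta = word (fun x y => w x * y).
  move=> dw; apply/ffunP=> -[y z]; apply: (mulgI g0).
  by rewrite betaE dw !ffunE mulgA.
have commE : (forall x y : gT, y * x = x * y) ->
    gamma = word (fun x y => x * y) /\ gamma = word (fun x y => y * x).
  by move=> C; move: gamma_in; rewrite !inE => /orP[]/eqP->; split;
    apply: eq_word=> x y //; rewrite C.
have group_case : beta = word (fun x y => x * y) ->
    gamma = word (fun x y => x * y) -> delta = word (fun x y => g0 * x * y) ->
    is_extra_loop (Qmul beta gamma delta) (Qone gT).
  by move=> -> -> ->; apply: (group_words_extra _ star).
have beta_id : (forall y, delta (y, 1) = g0 * y) ->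
    beta = word (fun x y => x * y) by apply: betaw (fun y => y).
move: (gamma_in) (delta_in); rewrite !inE => gammaP.
case/or4P=> [||| /or4P[||| /orP[]]] /eqP dE;
  (* The value of [delta (1, z)] excludes the four words that star the second variable. *)
  try by case: not_star => z; rewrite -[RHS]delta1 dE !ffunE /= ?s1 ?mulg1.
- have bE : beta = word (fun x y => x * y).
    by apply: beta_id => y; rewrite dE ffunE /= mulg1.
  left; case/orP: gammaP => /eqP gE; first exact: group_case.
  have C (x y : gT) : y * x = x * y.
    have := D x 1 y; rewrite bE gE dE !ffunE /= !mul1g -!mulgA.
    by move/mulgI/mulgI.
  by apply: group_case => //; case: (commE C).
- have bE : beta = word (fun x y => star x * y).
    by apply: betaw => y; rewrite dE ffunE /= mulg1.
  have C (x y : gT) : y * x = x * y.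
    case/orP: gammaP => /eqP gE.
      (* A middle variable 1 would give a trivial identity here; a last variable 1 gives
         [star x * star y = star y * star x]. *)
      have := D x y 1; rewrite bE gE dE !ffunE /= !mulg1 starM -!mulgA.
      move/mulgI; rewrite !mulgA => /mulIg; rewrite -!starM.
      exact: (can_inj starK).
    have := D x 1 y; rewrite bE gE dE !ffunE /= s1 !mul1g -!mulgA.
    by move/mulgI/mulgI.
  right; congr (_, _, _) => //; first by case: (commE C).
  by rewrite dE; apply: eq_word=> x y; rewrite -mulgA -[RHS]mulgA (C y).
- have bE : beta = word (fun x y => x * y).
    by apply: beta_id => y; rewrite dE ffunE /= mulg1.
  have C (x y : gT) : y * x = x * y.
    case/orP: gammaP => /eqP gE.
      have := D x 1 y; rewrite bE gE dE !ffunE /= !mulg1 !mul1g -!mulgA.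
      by move/mulgI/mulgI.
    (* A middle variable 1 would only show that squares are central; a last variable 1 gives y x x =
       x y x. *)
    have := D x y 1; rewrite bE gE dE !ffunE /= !mulg1 mul1g -!mulgA.
    by move/mulgI; rewrite !mulgA => /mulIg.
  left; apply: group_case => //; first by case: (commE C).
  by rewrite dE; apply: eq_word=> x y; rewrite -mulgA -[RHS]mulgA (C x).
- have bE : beta = word (fun x y => star x * y).
    by apply: betaw => y; rewrite dE ffunE /= mulg1.
  right; case/orP: gammaP => /eqP gE; last by rewrite bE gE dE.
  have C (x y : gT) : y * x = x * y.
    (* Starting from [star x] makes the star in delta restore x: the identity reads x^* y x = x^* x
       y. *)
    have := D (star x) 1 y.
    rewrite bE gE dE !ffunE /= s1 !mul1g !mulg1 !starK -!mulgA.
    by move/mulgI/mulgI.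
  by rewrite bE dE; case: (commE C) => _ ->.
Qed.
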